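(* Let $TI$ be the degree-based topological index determined by a symmetric function $h$, let $p_1,p_2\ge 0$ with $p_1+p_2\le 1$, let $RPC_n=RPC(n,p_1,p_2)$ be the random phenylene chain, and write $TI_n:=TI(RPC_n)$ for $n\ge 2$. Put $$A=2h_{2,3}-h_{2,2}-h_{3,3},\qquad B=h_{2,2}+2h_{2,3}+5h_{3,3},\qquad C=4h_{2,2}-6h_{3,3}.$$ Then: (a) for every $n\ge 2$, $TI_n=AX+Bn+C$ for a random variable $X\sim \mathrm{Binomial}(n-2,p_1)$; (b) for every $n\ge 2$, $\mathbb{E}(TI_n)=(Ap_1+B)n-2Ap_1+C$; (c) for every $n\ge 2$, $\mathbb{V}(TI_n)=A^2p_1(1-p_1)(n-2)$; (d) $\dfrac{TI_n-\mathbb{E}(TI_n)}{\sqrt{\mathbb{V}(TI_n)}}$ converges in distribution to $N(0,1)$ as $n\to\infty$; (e) $\dfrac{TI_n}{n}\to Ap_1+B$ almost surely as $n\to\infty$. In particular, for every (deterministic) phenylene chain $rpc_n$ containing $n\ge 2$ hexagons, $$TI(rpc_n)=An_1+Bn+C,$$ where $n_1$ is the number of type-1 links chosen up to time $n$, that is, in steps $3,\dots,n$ of the construction of $rpc_n$.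
   Context: Degree-based topological index: for a function $h$ with real values and $h(x,y)=h(y,x)$ for $x,y\in\{1,2,\dots\}$, $TI(G)=\sum_{uv\in E(G)}h(d_u,d_v)$ for a finite simple connected graph $G$, where $d_v$ is the degree of $v$ in $G$. Write $h_{x,y}:=h(x,y)$. $\mathbb{E}$ and $\mathbb{V}$ denote expectation and variance, and $N(0,1)$ is the standard normal law. Phenylene chains: hexagons (6-cycles) in which consecutive hexagons are joined through a square (4-cycle). $RPC_1$ is one hexagon. $RPC_2$ consists of two vertex-disjoint hexagons, with one edge $ab$ of the first and one edge $a'b'$ of the second, together with the two additional edges $aa'$ and $bb'$ (so $a,b,b',a'$ form a square). For $n\ge 3$, $RPC_n$ is obtained from $RPC_{n-1}$ as follows. Let the terminal (last added) hexagon of $RPC_{n-1}$ have vertices $c_1,c_2,c_3,c_4,c_5,c_6$ in cyclic order, where $c_1,c_2$ are its two vertices of degree 3. Choose an edge $e=ab$ of this hexagon, take a new vertex-disjoint hexagon with an edge $a'b'$, and add the edges $aa'$ and $bb'$. Link type 1 is the choice $e=c_4c_5$ (the edge opposite to $c_1c_2$); link types 2 and 3 are the choices $e=c_3c_4$ and $e=c_5c_6$. The new hexagon becomes the terminal one. Random phenylene chain $RPC(n,p_1,p_2)$: at each step $i\ge 3$ the link type $L_i\in\{1,2,3\}$ is chosen at random with $\mathbb{P}(L_i=1)=p_1$, $\mathbb{P}(L_i=2)=p_2$, $\mathbb{P}(L_i=3)=1-p_1-p_2$, with $L_3,L_4,\dots$ independent, and all $RPC_n$ are constructed successively on the same probability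 space. A deterministic phenylene chain $rpc_n$ is a graph obtained by this construction for a fixed choice of link types in steps $3,\dots,n$.
   Formalization: Part (d) is stated under the additional assumptions A ≠ 0 and 0 < p_1 < 1, since otherwise the variance of TI_n is zero for every n and the quotient is undefined. *)

(* Defs.v *)
From HB Require Import structures.
From mathcomp Require Import all_boot all_order all_algebra.
From mathcomp Require Import all_classical all_reals all_analysis.

Set Implicit Arguments.
Unset Strict Implicit.
Unset Printing Implicit Defensive.

Import Order.TTheory GRing.Theory Num.Theory.
Import numFieldNormedType.Exports.

Local Open Scope classical_set_scope.
Local Open Scope ring_scope.

Record sgraph := SGraph {
  vert :> finType;
  adj : rel vert;
  adj_sym : symmetric adj;
  adj_irr : irreflexive adj }.

Definition deg (G : sgraph) (v : G) : nat := #|[pred u | adj v u]|.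

(* The test on enum_rank lists every edge {u, v} exactly once. For the
   functions h considered below the value does not depend on the enumeration,
   since h is symmetric on positive integers and the ends of an edge have
   positive degree. *)
Definition TI (R : realType) (h : nat -> nat -> R) (G : sgraph) : R :=
  \sum_(u : G) \sum_(v : G | adj u v && (enum_rank u < enum_rank v)%N)
    h (deg u) (deg v).

(* In 'I_6 the ring operations are those of integers modulo 6. *)
Definition hex_adj : rel 'I_6 := fun i j => (j == i + 1) || (i == j + 1).

Lemma hex_adj_sym : symmetric hex_adj.
Proof. by move=> i j; rewrite /hex_adj orbC. Qed.

Lemma hex_adj_irr : irreflexive hex_adj.
Proof. by case; do 6?[case=> //]. Qed.

Definition hexagon : sgraph := SGraph hex_adj_sym hex_adj_irr.

(* The edge a'b' of the new hexagon is {0, 1}, which is no restriction since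
   all edges of a 6-cycle are equivalent: a' = 0 and b' = 1. *)
Definition glue_adj (G : sgraph) (a b : G) : rel (G + 'I_6)%type :=
  fun x y => match x, y with
  | inl u, inl v => adj u v
  | inr i, inr j => hex_adj i j
  | inl u, inr j | inr j, inl u => (u == a) && (j == 0) || (u == b) && (j == 1)
  end.

Lemma glue_adj_sym (G : sgraph) (a b : G) : symmetric (glue_adj a b).
Proof. by case=> [u|i] [v|j] //=; [exact: adj_sym | exact: hex_adj_sym]. Qed.

Lemma glue_adj_irr (G : sgraph) (a b : G) : irreflexive (glue_adj a b).
Proof. by case=> [u|i] /=; [exact: adj_irr | exact: hex_adj_irr]. Qed.

Definition glue (G : sgraph) (a b : G) : sgraph :=
  SGraph (glue_adj_sym a b) (glue_adj_irr a b).

(* A chain with at least two hexagons carries the cyclic labelling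
   c_1, ..., c_6 of its terminal hexagon, where c_k is [term G (k - 1)];
   thus c_1 and c_2 are [term G 0] and [term G 1]. *)
Record chain := Chain { cgraph :> sgraph; term : 'I_6 -> cgraph }.

(* After gluing, the vertices of degree 3 of the new hexagon are 0 and 1.
   There are two cyclic labellings that use them as c_1 and c_2: the identity
   and the reflection k |-> 1 - k. Either of them is allowed at each step. *)
Definition attach (G : sgraph) (a b : G) (refl : bool) : chain :=
  @Chain (glue a b) (fun k : 'I_6 => inr (if refl then 1 - k else k)).

Inductive link_type := Link1 | Link2 | Link3.

Definition ord_of_link (l : link_type) : 'I_3 :=
  match l with Link1 => 0 | Link2 => 1 | Link3 => 2%:R end.

Definition link_of_ord (i : 'I_3) : link_type :=
  match val i with 0%N => Link1 | 1%N => Link2 | _ => Link3 end.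

Lemma ord_of_linkK : cancel ord_of_link link_of_ord.
Proof. by case. Qed.

HB.instance Definition _ := Finite.copy link_type (can_type ord_of_linkK).
HB.instance Definition _ := isPointed.Build link_type Link1.
HB.instance Definition _ := @isMeasurable.Build default_measure_display
  link_type discrete_measurable discrete_measurable0
  discrete_measurableC discrete_measurableU.

(* c_4c_5, c_3c_4 and c_5c_6 respectively. *)
Definition link_edge (G : chain) (l : link_type) : G * G :=
  match l with
  | Link1 => (term G 3%:R, term G 4%:R)
  | Link2 => (term G 2%:R, term G 3%:R)
  | Link3 => (term G 4%:R, term G 5%:R)
  end.

Definition is_RPC2 (G : chain) : Prop :=
  exists (a b : hexagon) (refl : bool), adj a b /\ G = attach a b refl.

Definition chain_step (l : link_type) (G G' : chain) : Prop :=
  exists refl : bool, G' = attach (link_edge G l).1 (link_edge G l).2 refl.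

(* [phenylene_chain l n G]: G is a phenylene chain with n >= 2 hexagons in
   which link type [l i] was chosen at step i, for 3 <= i <= n. *)
Inductive phenylene_chain (l : nat -> link_type) : nat -> chain -> Prop :=
| phenylene_chain2 G : is_RPC2 G -> phenylene_chain l 2 G
| phenylene_chainS n G G' : (3 <= n)%N -> phenylene_chain l n.-1 G ->
    chain_step (l n) G G' -> phenylene_chain l n G'.

Definition mutually_independent d d' (T : measurableType d)
    (T' : measurableType d') (R : realType) (P : probability T R)
    (J : set nat) (X : nat -> {RV P >-> T'}) : Prop :=
  forall (s : seq nat) (E : nat -> set T'), uniq s -> [set` s] `<=` J ->
    (forall i, measurable (E i)) ->
  P (\bigcap_(i in [set` s]) (X i @^-1` E i)) =
    (\prod_(i <- s) P (X i @^-1` E i))%E.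

Definition random_phenylene_chain d (T : measurableType d) (R : realType)
    (P : probability T R) (p1 p2 : R) (L : nat -> {RV P >-> link_type})
    (RPC : nat -> T -> chain) : Prop :=
  [/\ forall i, (3 <= i)%N ->
        [/\ P (L i @^-1` [set Link1]) = p1%:E,
            P (L i @^-1` [set Link2]) = p2%:E &
            P (L i @^-1` [set Link3]) = (1 - p1 - p2)%:E],
      mutually_independent [set i | (3 <= i)%N] L,
      forall w, is_RPC2 (RPC 2 w) &
      forall w n, (3 <= n)%N -> chain_step (L n w) (RPC n.-1 w) (RPC n w)].

(* Convergence of the distribution functions at every continuity point of the
   limiting one. *)
Definition cvg_in_distribution d (T : measurableType d) (R : realType)
    (P : probability T R) (X : nat -> T -> R)
    (nu : probability (measurableTypeR R) R) : Prop :=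
  forall x : R, {for x, continuous (fun y : R => nu `]-oo, y]%classic)} ->
    P (X n @^-1` `]-oo, x]%classic) @[n --> \oo] --> nu `]-oo, x]%classic.

(* Main.v *)
Require Import Defs.
From HB Require Import structures.
From mathcomp Require Import all_boot all_order all_algebra.
From mathcomp Require Import all_classical all_reals all_analysis.
From mathcomp Require Import measurable_realfun.
From mathcomp Require Import ring lra.

(** The index of a phenylene chain depends on the choices made only through
    the number of type-1 links. Summed over ordered adjacent pairs, the index
    splits into contributions of the old graph, of the new hexagon and of the
    two connecting edges ([arcsum_glue]); gluing changes only two degrees, and
    these lie in the old terminal hexagon. So the increment of the index is a
    finite computation: it is B, plus A if the link has type 1
    ([TI_chain_step], [TI_phenylene_chain]).

    The number of type-1 links counts the successes in independent trials, so
    it has a binomial law ([distribution_successes]) and expectations of its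
    functions are finite sums [Ebinom]. These satisfy a recursion in
    the number of trials, [EbinomS], which yields the mean, the
    variance and a bound on the fourth central moment.

    The central limit theorem is proved by the replacement method, without
    characteristic functions. With [Phi] the normal distribution function,
    [heat a s x = Phi ((a - x) / sqrt s)] solves the heat equation. A centred
    trial of variance t therefore changes [heat a s] into [heat a (s + t)] up
    to an error which is small compared with t ([heat_step]). After n trials
    of variance 1/n, the expectation of [heat a r] at the standardized count
    is close to [heat a (r + 1) 0], for each fixed r > 0
    ([Ebinom_heat]). For small r, the function [heat a r] is a
    smoothed indicator of the half-line up to a, and [heat a (r + 1) 0] is
    close to [Phi a] ([binomial_clt]).

    The strong law follows from the fourth moment: the expectations of the
    fourth powers of the centred averages are summable, so these powers tend
    to 0 almost surely ([strong_law_successes]). *)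

Set Implicit Arguments.
Unset Strict Implicit.
Unset Printing Implicit Defensive.

Import Order.TTheory GRing.Theory Num.Theory.
Import numFieldNormedType.Exports.

Local Open Scope classical_set_scope.
Local Open Scope ring_scope.

(** * The index of a phenylene chain *)

Local Notation glue := Defs.glue.

Definition arcsum (R : realType) (G : sgraph) (F : G -> G -> R) : R :=
  \sum_(u : G) \sum_(v : G | adj u v) F u v.

(** Sums over ordered adjacent pairs split along a disjoint union of vertex
    sets, whereas the enumeration in [TI] mixes the two parts. An edge
    contributes the same value in both directions because its ends have
    positive degree, which is where [h] is symmetric. *)
Lemma arcsum_TI (R : realType) (h : nat -> nat -> R)
    (h_sym : forall x y : nat, (0 < x)%N -> (0 < y)%N -> h x y = h y x)
    (G : sgraph) :
  arcsum (fun u v : G => h (deg u) (deg v)) = 2 * TI h G.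
Proof.
have deg_gt0 (u v : G) : adj u v -> (0 < deg u)%N.
  by move=> uv; apply/card_gt0P; exists v.
transitivity (TI h G + \sum_(u : G) \sum_(v : G | adj u v &&
    (enum_rank v < enum_rank u)%N) h (deg u) (deg v)).
  rewrite -big_split /=; apply: eq_bigr => u _.
  rewrite (bigID (fun v => (enum_rank u < enum_rank v)%N)) /=.
  congr (_ + _); apply: eq_bigl => v.
  case uv: (adj u v) => //=; rewrite -leqNgt leq_eqVlt.
  case: eqP => //= /val_inj/enum_rank_inj vu.
  by rewrite vu adj_irr in uv.
rewrite mulrDl mul1r; congr (_ + _).
rewrite /TI (exchange_big_dep xpredT) //=; apply: eq_bigr => u _.
apply: eq_big => [v|v /andP[vu _]]; first by rewrite adj_sym.
by apply: h_sym; [exact: deg_gt0 vu|apply: (deg_gt0 _ v); rewrite adj_sym].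
Qed.

Lemma arcsum_hexagon (R : realType) (F : hexagon -> hexagon -> R) :
  arcsum F = \sum_(i < 6) (F i (i + 1) + F (i + 1) i).
Proof.
rewrite /arcsum big_split /=.
have -> : \sum_(i < 6) F (i + 1) i = \sum_(i < 6) F i (i - 1).
  rewrite (reindex_inj (addIr (-1 : 'I_6))) /=.
  by apply: eq_bigr => i _; rewrite subrK.
rewrite -big_split /=; apply: eq_bigr => i _.
rewrite (bigD1 (i + 1)) /=; last by rewrite /hex_adj eqxx.
congr (_ + _); rewrite (big_pred1 (i - 1)) // => j /=.
rewrite /hex_adj.
by case: i => -[|[|[|[|[|[|//]]]]]] ?; case: j => -[|[|[|[|[|[|//]]]]]] ?.
Qed.

Lemma arcsum_glue (R : realType) (G : sgraph) (a b : G)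
    (F : glue a b -> glue a b -> R) :
  arcsum F = arcsum (fun u v : G => F (inl u) (inl v))
    + (F (inl a) (inr 0) + F (inl b) (inr 1)
       + F (inr 0) (inl a) + F (inr 1) (inl b))
    + arcsum (fun i j : hexagon => F (inr i) (inr j)).
Proof.
have cross (f : G -> 'I_6 -> R) :
    \sum_u \sum_(j | (u == a) && (j == 0) || (u == b) && (j == 1)) f u j
      = f a 0 + f b 1.
  transitivity (\sum_u \sum_j ((if (u == a) && (j == 0) then f u j else 0)
      + (if (u == b) && (j == 1) then f u j else 0))).
    apply: eq_bigr => u _; rewrite big_mkcond /=; apply: eq_bigr => j _.
    by case: (eqVneq j 0) => [->|_];
      rewrite ?andbT ?andbF ?addr0 ?orbF ?add0r.
  under eq_bigr do rewrite big_split /=.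
  rewrite big_split /=; congr (_ + _).
    rewrite (bigD1 a) //= [X in _ + X]big1 => [|u /negbTE ->]; last first.
      by rewrite big1.
    rewrite addr0 (bigD1 0) //= eqxx big1 ?addr0 // => j /negbTE ->.
    by rewrite andbF.
  rewrite (bigD1 b) //= [X in _ + X]big1 => [|u /negbTE ->]; last first.
    by rewrite big1.
  rewrite addr0 (bigD1 1) //= eqxx big1 ?addr0 // => j /negbTE ->.
  by rewrite andbF.
rewrite {1}/arcsum big_sumType /=.
under eq_bigr => u _ do rewrite big_sumType /=.
under [X in _ + X]eq_bigr => i _ do rewrite big_sumType /=.
rewrite !big_split /= cross.
rewrite [X in _ + (X + _)](exchange_big_dep xpredT) //= cross.
rewrite -!addrA; do 2!congr (_ + _); congr (_ + _).
Qed.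

Lemma deg_glue_inl (G : sgraph) (a b u : G) :
  deg (inl u : glue a b) = (deg u + (u == a) + (u == b))%N.
Proof.
rewrite /deg -!sum1_card big_sumType /= -addnA; congr (_ + _)%N.
rewrite (_ : \sum_(j | _) 1 = \sum_(j : 'I_6)
    ((if (u == a) && (j == 0%R) then 1 else 0)
     + (if (u == b) && (j == 1%R) then 1 else 0)))%N; last first.
  rewrite big_mkcond /=; apply: eq_bigr => j _; rewrite unfold_in /=.
  by case: (eqVneq j 0) => [->|_]; rewrite ?andbT ?andbF ?addn0 ?orbF ?add0n.
rewrite big_split /= (bigD1 0) //= big1 => [|j /negbTE ->]; last by rewrite andbF.
rewrite (bigD1 1) //= big1 => [|j /negbTE ->]; last by rewrite andbF.
by rewrite !eqxx !andbT; case: (u == a); case: (u == b).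
Qed.

Lemma deg_hexagon (i : hexagon) : deg i = 2%N.
Proof.
rewrite /deg -sum1_card big_mkcond !big_ord_recl big_ord0.
by case: i => -[|[|[|[|[|[|//]]]]]] ?.
Qed.

Lemma deg_glue_inr (G : sgraph) (a b : G) (i : 'I_6) :
  deg (inr i : glue a b) = (2 + (i == 0%R) + (i == 1%R))%N.
Proof.
transitivity (deg (i : hexagon) + (i == 0%R) + (i == 1%R))%N; last first.
  by rewrite deg_hexagon.
rewrite /deg -!sum1_card big_sumType /= addnC -addnA.
congr (_ + _)%N.
rewrite (_ : \sum_(u | _) 1 = \sum_(u : G)
    ((if (u == a) && (i == 0%R) then 1 else 0)
     + (if (u == b) && (i == 1%R) then 1 else 0)))%N; last first.
  rewrite big_mkcond /=; apply: eq_bigr => j _; rewrite unfold_in /=.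
  by case: (eqVneq i 0) => [->|_]; rewrite ?andbT ?andbF ?addn0 ?orbF ?add0n.
rewrite big_split /= (bigD1 a) //= big1 => [|j /negbTE ->] //.
rewrite (bigD1 b) //= big1 => [|j /negbTE ->] //.
by rewrite !eqxx; case: (i == 0%R); case: (i == 1%R).
Qed.

Section TI_chain.
Variables (R : realType) (h : nat -> nat -> R).
Hypothesis h_sym : forall x y : nat, (0 < x)%N -> (0 < y)%N -> h x y = h y x.

Let A := 2 * h 2%N 3%N - h 2%N 2%N - h 3%N 3%N.
Let B := h 2%N 2%N + 2 * h 2%N 3%N + 5 * h 3%N 3%N.
Let C := 4 * h 2%N 2%N - 6 * h 3%N 3%N.

Definition hexsum (d : 'I_6 -> nat) : R :=
  arcsum (fun i j : hexagon => h (d i) (d j)).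

Lemma TI_glue (G : sgraph) (a b : G) : a != b ->
  2 * TI h (glue a b) =
    arcsum (fun u v : G => h (deg u + (u == a) + (u == b))
                             (deg v + (v == a) + (v == b)))
    + 2 * (h (deg a).+1 3%N + h (deg b).+1 3%N)
    + hexsum (fun i => 2 + (i == 0%R) + (i == 1%R))%N.
Proof.
move=> ab; rewrite -arcsum_TI // arcsum_glue /hexsum.
congr (_ + _ + _).
- apply: eq_bigr => u _; apply: eq_bigr => v _.
  by rewrite !deg_glue_inl.
- rewrite !deg_glue_inl !deg_glue_inr !eqxx [b == a]eq_sym (negbTE ab) /=.
  rewrite !addn0 !addn1 !(h_sym (x := 3%N)) //; ring.
- apply: eq_bigr => u _; apply: eq_bigr => v _.
  by rewrite !deg_glue_inr.
Qed.

(** Gluing a further hexagon to the last hexagon changes no degree outside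
    that hexagon, and leaves the two vertices that carry its older connecting
    edges at degree 3. So both indices contain the same contribution of [G]
    and of those edges, and what remains is a sum inside one hexagon. *)
Lemma TI_glue_terminal (G : sgraph) (a b : G) (i j : 'I_6) :
  i != j -> i \notin [:: 0; 1] -> j \notin [:: 0; 1] ->
  2 * TI h (glue (inr i : glue a b) (inr j : glue a b)) =
  2 * TI h (glue a b) + 4 * h 3%N 3%N
  + hexsum (fun k => 2 + (k == 0%R) + (k == 1%R) + (k == i) + (k == j))%N.
Proof.
rewrite !inE !negb_or => ij /andP[i0 i1] /andP[j0 j1].
rewrite TI_glue // -(arcsum_TI h_sym (glue a b)) !arcsum_glue.
rewrite !deg_glue_inr (negbTE i0) (negbTE i1) (negbTE j0) (negbTE j1) /=.
rewrite !(inj_eq (@inr_inj _ _)) ![0 == _]eq_sym ![1 == _]eq_sym.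
rewrite (negbTE i0) (negbTE i1) (negbTE j0) (negbTE j1) /=.
have deg_a : (0 < deg (inl a : glue a b))%N by rewrite deg_glue_inl eqxx addn1.
have deg_b : (0 < deg (inl b : glue a b))%N by rewrite deg_glue_inl eqxx addn1.
rewrite !addn0 !addn1 !(h_sym (x := 3%N)) //.
pose t0 (u : G) : glue a b := inl u.
have -> : arcsum (fun u v : G => h (deg (t0 u) + 0 + 0) (deg (t0 v) + 0 + 0)) =
    arcsum (fun u v : G => h (deg (t0 u)) (deg (t0 v))).
  by apply: eq_bigr => u _; apply: eq_bigr => v _; rewrite !addn0.
pose t (k : 'I_6) : glue a b := inr k.
have -> : arcsum (fun k m : hexagon =>
    h (deg (t k) + (t k == t i) + (t k == t j))
      (deg (t m) + (t m == t i) + (t m == t j))) =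
    hexsum (fun k => 2 + (k == 0%R) + (k == 1%R) + (k == i) + (k == j))%N.
  by apply: eq_bigr => k _; apply: eq_bigr => m _; rewrite !deg_glue_inr.
have -> : arcsum (fun k m : hexagon => h (deg (t k)) (deg (t m))) =
    hexsum (fun k => 2 + (k == 0%R) + (k == 1%R))%N.
  by apply: eq_bigr => k _; apply: eq_bigr => m _; rewrite !deg_glue_inr.
ring.
Qed.

(** Turns a hexagon sum into six explicit terms, the degrees being read off
    from a list in cyclic order. *)
Lemma hexsum_nth (d : 'I_6 -> nat) (s : seq nat) :
  (forall i : 'I_6, d i = nth 0%N s i) ->
  let t k := h (nth 0%N s k) (nth 0%N s (k.+1 %% 6))
    + h (nth 0%N s (k.+1 %% 6)) (nth 0%N s k) in
  hexsum d = t 0%N + t 1%N + t 2%N + t 3%N + t 4%N + t 5%N.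
Proof.
move=> ds t; rewrite /hexsum arcsum_hexagon !big_ord_recl big_ord0 !ds /= addr0.
by rewrite -!addrA.
Qed.

Lemma TI_RPC2 (G : chain) : is_RPC2 G -> TI h G = 2 * B + C.
Proof.
move=> [a [b [r [ab ->]]]]; have a_b : a != b.
  by apply: contraTneq ab => ->; rewrite adj_irr.
apply: (@mulfI _ 2); first by rewrite pnatr_eq0.
rewrite TI_glue // !deg_hexagon.
have -> : arcsum (fun u v : hexagon => h (deg u + (u == a) + (u == b))
    (deg v + (v == a) + (v == b))) =
    hexsum (fun i => 2 + (i == a) + (i == b))%N.
  by apply: eq_bigr => u _; apply: eq_bigr => v _; rewrite !deg_hexagon.
rewrite (@hexsum_nth _ (mkseq (fun k => 2 + (k == a) + (k == b))%N 6));
  last by move=> i; rewrite nth_mkseq.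
rewrite (@hexsum_nth _ [:: 3; 3; 2; 2; 2; 2]%N); last first.
  by case=> -[|[|[|[|[|[|//]]]]]].
case: a b ab {a_b} => -[|[|[|[|[|[|//]]]]]] ? [] -[|[|[|[|[|[|//]]]]]] ? //= _;
  rewrite /B /C !(h_sym (x := 3%N) (y := 2%N)) //; ring.
Qed.

(** The lists are the degrees of the old terminal hexagon after the step,
    numbered as in [glue], for each link type and each of the two labellings
    of that hexagon. *)
Lemma TI_chain_step l (G0 : sgraph) (a b : G0) r (G' : chain) :
  chain_step l (attach a b r) G' ->
  TI h G' = TI h (glue a b) + A * (l == Link1)%:R + B.
Proof.
case=> r' -> /=; apply: (@mulfI _ 2); first by rewrite pnatr_eq0.
case: l; case: r; rewrite /= TI_glue_terminal //;
  [rewrite (@hexsum_nth _ [:: 3; 3; 2; 3; 3; 2]%N)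
  |rewrite (@hexsum_nth _ [:: 3; 3; 2; 3; 3; 2]%N)
  |rewrite (@hexsum_nth _ [:: 3; 3; 2; 2; 3; 3]%N)
  |rewrite (@hexsum_nth _ [:: 3; 3; 3; 3; 2; 2]%N)
  |rewrite (@hexsum_nth _ [:: 3; 3; 3; 3; 2; 2]%N)
  |rewrite (@hexsum_nth _ [:: 3; 3; 2; 2; 3; 3]%N)];
  try (by case=> -[|[|[|[|[|[|//]]]]]]);
  rewrite /= /A /B !(h_sym (x := 3%N) (y := 2%N)) //; ring.
Qed.

Lemma TI_phenylene_chain (l : nat -> link_type) (n : nat) (G : chain) :
  phenylene_chain l n G ->
  TI h G = A * (\sum_(3 <= i < n.+1) (l i == Link1))%:R + B * n%:R + C.
Proof.
(* The step formula needs the chain to end with a glued hexagon. *)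
move=> lG; suff [] : TI h G =
      A * (\sum_(3 <= i < n.+1) (l i == Link1))%:R + B * n%:R + C
    /\ exists (G0 : sgraph) (a b : G0) r, G = attach a b r by [].
elim: lG => {n G} [G G2|n G G' n_ge3 lG [IH [G0 [a [b [r GE]]]]] GG'].
  split; first by rewrite big_geq // mulr0 add0r mulrC TI_RPC2.
  by case: G2 => a [b [r [_ ->]]]; exists hexagon, a, b, r.
split; last first.
  case: GG' => r' ->.
  by exists G, (link_edge G (l n)).1, (link_edge G (l n)).2, r'.
move: GG'; rewrite GE => /TI_chain_step ->.
move: IH; rewrite GE /= => ->.
case: n n_ge3 {lG} => // n n_ge3 /=.
rewrite [X in _ = A * X%:R + _ + _]big_nat_recr //= natrD -[in RHS]natr1.
by ring.
Qed.

End TI_chain.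

(** * The standard normal distribution function *)

Section gauss.
Variable R : realType.
Implicit Types (x y z : R).

Definition Phi x : R := fine (normal_prob 0 1 `]-oo, x]%classic).
Definition phi x : R := normal_pdf 0 1 x.

Lemma phiE x : phi x = phi 0 * expR (- (x ^+ 2 / 2)).
Proof.
rewrite /phi normal_pdfE ?oner_eq0 // /normal_fun subr0 subrr expr0n /=.
by rewrite oppr0 mul0r expR0 mulr1 expr1n mulNr.
Qed.

Lemma phi0_gt0 : 0 < phi 0.
Proof.
rewrite /phi normal_pdfE ?oner_eq0 // mulr_gt0 ?normal_peak_gt0 ?oner_eq0 //.
exact: expR_gt0.
Qed.

Lemma is_derive_Phi x : is_derive x 1 Phi (phi x).
Proof.
have i y : lebesgue_measure.-integrable [set` `]-oo, y]%R]
    (EFin \o @normal_pdf R 0 1).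
  by apply: (integrableS measurableT) => //; exact: integrable_normal_pdf.
have [] := @continuous_FTC1 R (@normal_pdf R 0 1) (BInfty _ true) x (x + 1).
- by rewrite ltrDl.
- exact: i.
- by rewrite ltNyr.
- exact: (@continuous_normal_pdf R 0 1 (oner_neq0 _)).
move=> dF F'; split; first exact: dF.
by rewrite -derive1E; exact: F'.
Qed.

Lemma is_derive_phi x : is_derive x 1 phi (- x * phi x).
Proof.
rewrite (_ : phi = fun x => phi 0 * expR (- (x ^+ 2 / 2))); last first.
  by apply/funext => y; rewrite -phiE.
apply: is_derive_eq.
by rewrite /GRing.scale /=; field.
Qed.

(** The exponential of [z ^+ 2 / 2] is the square of that of [z ^+ 2 / 4], so
    it dominates the square of [1 + z ^+ 2 / 4], a polynomial of degree 4. All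
    derivatives of the Gaussian test functions below are controlled by it. *)
Lemma phi_poly_bound z : (1 + z ^+ 2 + z ^+ 4) * phi z <= 16 * phi 0.
Proof.
rewrite phiE mulrCA mulrC ler_pM2r ?phi0_gt0 // expRN ler_pdivrMr ?expR_gt0 //.
have e : 1 + z ^+ 2 / 4 <= expR (z ^+ 2 / 4) by exact: expR_ge1Dx.
have -> : z ^+ 2 / 2 = z ^+ 2 / 4 + z ^+ 2 / 4 by field.
rewrite expRD.
have z2 : 0 <= z ^+ 2 by exact: sqr_ge0.
apply: (@le_trans _ _ (16 * ((1 + z ^+ 2 / 4) * (1 + z ^+ 2 / 4)))).
  nra.
rewrite ler_pM2l //; apply: ler_pM => //; lra.
Qed.

Lemma phi_ge0 z : 0 <= phi z. Proof. exact: normal_pdf_ge0. Qed.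

Lemma phi_mul_bound z y : `|y| <= 1 + z ^+ 2 + z ^+ 4 ->
  `|y * phi z| <= 16 * phi 0.
Proof.
move=> yz; rewrite normrM (ger0_norm (phi_ge0 z)).
by apply: le_trans (phi_poly_bound z); rewrite ler_wpM2r ?phi_ge0.
Qed.

Lemma Phi_fin x : normal_prob 0 1 `]-oo, x]%classic = (Phi x)%:E.
Proof. by rewrite fineK // fin_num_measure. Qed.

(** [Phi] is the distribution function of this variable under the normal law,
    which gives access to the limits of distribution functions at infinity. *)
Let id_RV : measurableTypeR R -> R := idfun.
Let id_RV_meas : measurable_fun setT id_RV. Proof. exact: measurable_id. Qed.
HB.instance Definition _ := isMeasurableFun.Build _ _ _ _ id_RV id_RV_meas.

Lemma Phi_le x y : x <= y -> Phi x <= Phi y.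
Proof.
move=> xy; rewrite -lee_fin -!Phi_fin le_measure ?inE //.
by apply: subset_itvl; rewrite bnd_simp.
Qed.

Lemma Phi_ge0 x : 0 <= Phi x.
Proof. by rewrite fine_ge0. Qed.

Lemma Phi_le1 x : Phi x <= 1.
Proof. by rewrite -lee_fin -Phi_fin probability_le1. Qed.

Lemma cvg_Phiy : Phi x @[x --> +oo] --> (1 : R).
Proof.
have := @cvg_cdfy1 _ _ _ (normal_prob 0 1) id_RV.
move/fine_cvg; exact.
Qed.

Lemma cvg_PhiNy : Phi x @[x --> -oo] --> (0 : R).
Proof.
have := @cvg_cdfNy0 _ _ _ (normal_prob 0 1) id_RV.
move/fine_cvg; exact.
Qed.

End gauss.

(** * Taylor bounds *)

Section taylor.
Variable R : realType.
Implicit Types (f df d2f d3f : R -> R) (a b x y M : R).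

Lemma mvt_bound f df a b M : a <= b ->
  (forall x, a <= x <= b -> is_derive x 1 f (df x)) ->
  (forall x, a <= x <= b -> `|df x| <= M) -> `|f b - f a| <= M * (b - a).
Proof.
move=> ab fd dfM.
have [c cab ->] : exists2 c, c \in `[a, b]%R & f b - f a = df c * (b - a).
  apply: MVT_segment => // [x|].
    rewrite in_itv /= => /andP[ax xb]; apply: fd.
    by rewrite (ltW ax) (ltW xb).
  apply: continuous_in_subspaceT => x; rewrite inE /= in_itv /= => xab.
  apply: differentiable_continuous; apply/derivable1_diffP.
  by have [] := fd x xab.
rewrite normrM (@ger0_norm _ (b - a)) ?subr_ge0 // ler_wpM2r ?subr_ge0 //.
by apply: dfM; rewrite in_itv /= in cab.
Qed.

Lemma mvt_dist f df x y M : (forall z : R, is_derive z 1 f (df z)) ->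
  (forall z, `|z - x| <= `|y - x| -> `|df z| <= M) ->
  `|f y - f x| <= M * `|y - x|.
Proof.
move=> fd dfM; have [xy|/ltW yx] := leP x y.
  rewrite (@ger0_norm _ (y - x)) ?subr_ge0 //.
  apply: mvt_bound => // z /andP[xz zy].
  by apply: dfM; rewrite !ger0_norm ?subr_ge0 // lerD2r.
rewrite distrC (@ler0_norm _ (y - x)) ?subr_le0 // opprB.
apply: mvt_bound => // z /andP[yz zx].
by apply: dfM; rewrite !ler0_norm ?subr_le0 // !opprB lerD2l lerN2.
Qed.

Lemma taylor1 f df d2f a t M : 0 <= t ->
  (forall x, a <= x -> is_derive x 1 f (df x)) ->
  (forall x, a <= x -> is_derive x 1 df (d2f x)) ->
  (forall x, a <= x -> `|d2f x| <= M) ->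
  `|f (a + t) - f a - t * df a| <= M * t ^+ 2.
Proof.
move=> t0 fd dfd d2fM.
have M0 : 0 <= M by apply: le_trans (d2fM a (lexx a)).
pose g x := f x - df a * x.
have -> : f (a + t) - f a - t * df a = g (a + t) - g a by rewrite /g; ring.
have -> : M * t ^+ 2 = (M * t) * (a + t - a) by ring.
apply: (@mvt_bound _ (fun x => df x - df a)) =>
  [|x /andP[ax xt]|x /andP[ax xt]].
- by rewrite lerDl.
- have := fd x ax => ?; apply: is_derive_eq.
  by rewrite /GRing.scale /= mulr1 ?mulr0 ?addr0; ring.
- apply: (@le_trans _ _ (M * (x - a))).
    apply: mvt_bound => // y /andP[ay _]; [exact: dfd|exact: d2fM].
  by rewrite ler_wpM2l // lerBlDl.
Qed.

(** Constants are not optimal: the mean value theorem applied to the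
    remainder, and twice more to its derivative, gives 1 instead of 1/6. *)
Lemma taylor2 f df d2f d3f M :
  (forall x : R, is_derive x 1 f (df x)) ->
  (forall x : R, is_derive x 1 df (d2f x)) ->
  (forall x : R, is_derive x 1 d2f (d3f x)) -> (forall x, `|d3f x| <= M) ->
  forall x t,
    `|f (x + t) - f x - t * df x - t ^+ 2 / 2 * d2f x| <= M * `|t| ^+ 3.
Proof.
move=> fd dfd d2fd d3fM x t.
have M0 : 0 <= M by apply: le_trans (d3fM x).
pose g y := f y - (y - x) * df x - (y - x) ^+ 2 / 2 * d2f x.
pose dg y := df y - df x - (y - x) * d2f x.
have dgE y : `|dg y| <= M * `|y - x| ^+ 2.
  pose k z := df z - (z - x) * d2f x.
  have -> : dg y = k y - k x by rewrite /k /dg; ring.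
  have -> : M * `|y - x| ^+ 2 = M * `|y - x| * `|y - x| by ring.
  apply: (@mvt_dist k (fun z => d2f z - d2f x)) => [z|z zy].
    apply: is_derive_eq.
    rewrite /GRing.scale /=; ring.
  apply: (@le_trans _ _ (M * `|z - x|)); first exact: mvt_dist.
  by rewrite ler_wpM2l.
have -> : f (x + t) - f x - t * df x - t ^+ 2 / 2 * d2f x =
    g (x + t) - g x.
  by rewrite /g; field.
have -> : M * `|t| ^+ 3 = M * `|t| ^+ 2 * `|x + t - x|.
  by rewrite [x + t]addrC addrK; ring.
apply: (@mvt_dist g dg) => [z|z zt].
  apply: is_derive_eq.
  by rewrite /dg /GRing.scale /=; field.
apply: le_trans (dgE z) _; rewrite ler_wpM2l //.
by move: zt; rewrite [x + t]addrC addrK => ?; rewrite lerXn2r ?nnegrE.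
Qed.

End taylor.

(** * The heat equation and one trial *)

Section heat.
Variable R : realType.
Implicit Types (a s x z c p t r : R).

Let K : R := 16 * phi 0.

(** A probability: that [x] plus a centred normal variable of variance [s] is
    at most [a]. As a function of [s] and [x] it solves the heat equation, the
    derivative in [s] being half the second derivative in [x]; this is visible
    in [heat_dxx] and [heat_ds]. *)
Definition heat a s x : R := Phi ((a - x) / Num.sqrt s).

Let dz (a s x : R) : 0 < s ->
  is_derive x 1 (fun x => (a - x) / Num.sqrt s) (- (Num.sqrt s)^-1).
Proof.
by move=> s0; apply: is_derive_eq; rewrite /GRing.scale /=; ring.
Qed.

Lemma heat_dx a s x : 0 < s ->
  is_derive x 1 (heat a s) (- phi ((a - x) / Num.sqrt s) / Num.sqrt s).
Proof.
move=> s0; have := is_derive1_comp (is_derive_Phi _) (dz a x s0).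
by rewrite mulrN -mulNr.
Qed.

Lemma heat_dxx a s x : 0 < s ->
  is_derive x 1 (fun x => - phi ((a - x) / Num.sqrt s) / Num.sqrt s)
    (- ((a - x) / Num.sqrt s) * phi ((a - x) / Num.sqrt s) / s).
Proof.
move=> s0; have d := is_derive1_comp (is_derive_phi _) (dz a x s0).
have q : Num.sqrt s != 0 by rewrite gt_eqF // sqrtr_gt0.
have sE : s = Num.sqrt s * Num.sqrt s by rewrite -expr2 sqr_sqrtr // ltW.
have h := @is_deriveM R _ (fun x => - phi ((a - x) / Num.sqrt s))
  (cst (Num.sqrt s)^-1) x 1 _ _ (is_deriveN d) (is_derive_cst _ _ _).
apply: (is_derive_eq h); rewrite /GRing.scale /=.
move: q sE; set q := Num.sqrt s => q0 sE.
by rewrite [X in _ = _ / X]sE; field.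
Qed.

Lemma heat_dxxx a s x : 0 < s ->
  is_derive x 1
    (fun x => - ((a - x) / Num.sqrt s) * phi ((a - x) / Num.sqrt s) / s)
    ((1 - ((a - x) / Num.sqrt s) ^+ 2) * phi ((a - x) / Num.sqrt s) /
     (s * Num.sqrt s)).
Proof.
move=> s0; have d := is_derive1_comp (is_derive_phi _) (dz a x s0).
have s_neq0 : s != 0 by rewrite gt_eqF.
have q : Num.sqrt s != 0 by rewrite gt_eqF // sqrtr_gt0.
have h1 := is_deriveM (is_deriveN (dz a x s0)) d.
have h := is_deriveM h1 (is_derive_cst s^-1 _ _).
apply: (is_derive_eq h); rewrite /GRing.scale ?fctE /=.
set z := (a - x) / _; set f := phi z; set q1 := Num.sqrt s.
by field; rewrite q s_neq0.
Qed.

Let dzs (a s x : R) : 0 < s ->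
  is_derive s 1 (fun s => (a - x) / Num.sqrt s)
   (- ((a - x) / Num.sqrt s) / (2 * s)).
Proof.
move=> s0; have q : Num.sqrt s != 0 by rewrite gt_eqF // sqrtr_gt0.
have sE : s = Num.sqrt s * Num.sqrt s by rewrite -expr2 sqr_sqrtr // ltW.
have h := is_deriveM (is_derive_cst (a - x) _ _)
  (is_deriveV q (is_derive1_sqrt s0)).
apply: (is_derive_eq h); rewrite /GRing.scale /=.
move: q sE; set q := Num.sqrt s => q0 sE.
by rewrite [X in _ = _ / (2 * X)]sE; field; rewrite q0.
Qed.

Lemma heat_ds a s x : 0 < s ->
  is_derive s 1 (fun s => heat a s x)
    (- ((a - x) / Num.sqrt s) * phi ((a - x) / Num.sqrt s) / s / 2).
Proof.
move=> s0; have s_neq0 : s != 0 by rewrite gt_eqF.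
apply: (is_derive_eq (is_derive1_comp (is_derive_Phi _) (dzs a x s0))).
set z := (a - x) / _; set f := phi z; field.
by rewrite s_neq0.
Qed.

Lemma heat_dss a s x : 0 < s ->
  let z := (a - x) / Num.sqrt s in
  is_derive s 1
    (fun s => - ((a - x) / Num.sqrt s) * phi ((a - x) / Num.sqrt s) / s / 2)
    ((3 * z - z ^+ 3) / 4 * phi z / s ^+ 2).
Proof.
move=> s0 z; have s_neq0 : s != 0 by rewrite gt_eqF.
have d := is_derive1_comp (is_derive_phi _) (dzs a x s0).
have h1 := is_deriveM (is_deriveN (dzs a x s0)) d.
have h2 := is_deriveM h1 (is_deriveV s_neq0 (is_derive_id _ _)).
have h := is_deriveM h2 (is_derive_cst (2^-1 : R) _ _).
apply: (is_derive_eq h); rewrite /GRing.scale ?fctE /= -/z.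
by set f := phi z; field; rewrite s_neq0.
Qed.

(** One centred two-valued trial of variance [t] acts on [heat a s] like an
    increase of [s] by [t]: the expansions in [x] to second order and in [s]
    to first order agree, since the trial has mean 0 and since [heat] solves
    the heat equation. The error is the third-order term in [x], of order
    [`|c| * t], plus the second-order term in [s]. *)
Lemma heat_step a r s x p c t : 0 < r -> r <= s -> 0 <= p <= 1 ->
  p * (1 - p) * c ^+ 2 = t ->
  `|p * heat a s (x + (1 - p) * c) + (1 - p) * heat a s (x - p * c)
    - heat a (s + t) x| <=
  K / (r * Num.sqrt r) * (`|c| * t) + K / r ^+ 2 * t ^+ 2.
Proof.
move=> r0 rs /andP[p0 p1] tE.
have s0 : 0 < s by exact: lt_le_trans rs.
have t0 : 0 <= t by rewrite -tE mulr_ge0 ?sqr_ge0 // mulr_ge0 ?subr_ge0.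
have K0 : 0 <= K by rewrite mulr_ge0 // ltW // phi0_gt0.
have := @taylor2 R (heat a s) _ _ _ (K / (r * Num.sqrt r))
  (fun y => heat_dx a y s0) (fun y => heat_dxx a y s0)
  (fun y => heat_dxxx a y s0).
set z := fun y : R => (a - y) / Num.sqrt s.
set d1 := fun y : R => - phi (z y) / Num.sqrt s.
set d2 := fun y : R => - z y * phi (z y) / s.
have d3M y : `|(1 - z y ^+ 2) * phi (z y) / (s * Num.sqrt s)| <=
    K / (r * Num.sqrt r).
  rewrite normrM ler_pM //.
    apply: phi_mul_bound; have := sqr_ge0 (z y); have := sqr_ge0 (z y ^+ 2).
    rewrite -exprM ler_norml => ? ?; apply/andP; split; lra.
  rewrite ger0_norm ?invr_ge0 ?mulr_ge0 ?sqrtr_ge0 ?(ltW s0) //.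
  rewrite lef_pV2 ?posrE ?mulr_gt0 ?sqrtr_gt0 //.
  by apply: ler_pM; rewrite ?sqrtr_ge0 ?(ltW r0) // ler_wsqrtr.
move=> /(_ d3M x) T.
have T1 := T ((1 - p) * c); have T2 := T (- (p * c)).
have d2M y : s <= y ->
    `|(3 * ((a - x) / Num.sqrt y) - ((a - x) / Num.sqrt y) ^+ 3) / 4
      * phi ((a - x) / Num.sqrt y) / y ^+ 2| <= K / r ^+ 2.
  move=> sy; have y0 : 0 < y by exact: lt_le_trans sy.
  set w := (a - x) / Num.sqrt y.
  rewrite normrM ler_pM //.
    apply: phi_mul_bound.
    have w2 := sqr_ge0 w; have w4 := sqr_ge0 (w ^+ 2).
    have := sqr_ge0 (w + 1); have := sqr_ge0 (w - 1).
    have := sqr_ge0 (w ^+ 2 + w); have := sqr_ge0 (w ^+ 2 - w).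
    rewrite ler_norml => ? ? ? ?; apply/andP; split; nra.
  rewrite ger0_norm ?invr_ge0 ?sqr_ge0 //.
  rewrite lef_pV2 ?posrE ?exprn_gt0 //.
  by rewrite lerXn2r ?nnegrE ?(ltW r0) ?(ltW y0) // (le_trans rs).
have := @taylor1 R (fun s => heat a s x) _ _ s t (K / r ^+ 2) t0
  (fun y sy => heat_ds a x (lt_le_trans s0 sy))
  (fun y sy => heat_dss a x (lt_le_trans s0 sy)) d2M.
rewrite -/(z x) -/(d2 x) => T3.
have M0 : 0 <= K / (r * Num.sqrt r).
  by rewrite divr_ge0 // mulr_ge0 ?sqrtr_ge0 // ltW.
move: T1 T2 T3; set M := K / (r * Num.sqrt r) => T1 T2 T3.
pose e1 := heat a s (x + (1 - p) * c) - heat a s x - (1 - p) * c * d1 x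
  - ((1 - p) * c) ^+ 2 / 2 * d2 x.
pose e2 := heat a s (x - p * c) - heat a s x - (- (p * c)) * d1 x
  - (- (p * c)) ^+ 2 / 2 * d2 x.
pose e3 := heat a (s + t) x - heat a s x - t * (d2 x / 2).
have -> : p * heat a s (x + (1 - p) * c) + (1 - p) * heat a s (x - p * c)
    - heat a (s + t) x = p * e1 + (1 - p) * e2 - e3.
  by rewrite /e1 /e2 /e3 -tE; field.
apply: le_trans (ler_normB _ _) _; apply: lerD => //.
apply: le_trans (ler_normD _ _) _.
rewrite !normrM (ger0_norm p0) (@ger0_norm _ (1 - p)) ?subr_ge0 //.
apply: (@le_trans _ _ (p * (M * `|(1 - p) * c| ^+ 3)
    + (1 - p) * (M * `|- (p * c)| ^+ 3))).
  by apply: lerD; rewrite ler_wpM2l ?subr_ge0.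
rewrite normrN !normrM (ger0_norm p0) (@ger0_norm _ (1 - p)) ?subr_ge0 // -tE.
rewrite -(real_normK (num_real c)).
rewrite [leRHS](_ : _ = M * (`|c| ^+ 3 * (p * (1 - p)))); last by ring.
rewrite [leLHS](_ : _ =
  M * (`|c| ^+ 3 * (p * (1 - p)) * ((1 - p) ^+ 2 + p ^+ 2))); last by ring.
rewrite ler_wpM2l // ler_piMr ?mulr_ge0 ?exprn_ge0 ?subr_ge0 //; nra.
Qed.

End heat.

(** * Expectations under the binomial law *)

Section binomial_expectation.
Variables (R : realType) (p : R).

Definition Ebinom (n : nat) (f : nat -> R) : R :=
  \sum_(k < n.+1) binomial_pmf n p k * f k.

Lemma binomial_pmfE n k :
  binomial_pmf n p k = p ^+ k * (1 - p) ^+ (n - k) *+ 'C(n, k).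
Proof. by []. Qed.

Lemma binomial_pmfS n k :
  binomial_pmf n.+1 p k.+1 =
  p * binomial_pmf n p k + (1 - p) * binomial_pmf n p k.+1.
Proof.
rewrite !binomial_pmfE binS addnC mulrnDr subSS exprS -mulrA mulrnAr; congr (_ + _).
have [kn|nk] := ltnP k n; last by rewrite bin_small // !mulr0n mulr0.
rewrite -(subnSK kn) [(1 - p) ^+ _.+1]exprS. rewrite mulrnAr; congr (_ *+ _).
by rewrite !mulrA; congr (_ * _); rewrite mulrC mulrA.
Qed.

Lemma binomial_pmfS0 n : binomial_pmf n.+1 p 0 = (1 - p) * binomial_pmf n p 0.
Proof. by rewrite !binomial_pmfE !bin0 !subn0 !expr0 !mul1r !mulr1n exprS. Qed.

Lemma binomial_pmf_small n k : (n < k)%N -> binomial_pmf n p k = 0.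
Proof. by move=> nk; rewrite !binomial_pmfE bin_small // mulr0n. Qed.

(** Conditioning on the last trial. Moments and the comparison with the normal
    law all follow from this recursion by induction on [n]. *)
Lemma EbinomS n f :
  Ebinom n.+1 f = Ebinom n (fun k => p * f k.+1 + (1 - p) * f k).
Proof.
rewrite /Ebinom big_ord_recl /= binomial_pmfS0.
under eq_bigr do rewrite /bump /= add1n binomial_pmfS mulrDl.
under [RHS]eq_bigr do rewrite mulrDr.
rewrite !big_split /= addrCA; congr (_ + _).
  by apply: eq_bigr => k _; ring.
transitivity ((1 - p) * \sum_(k < n.+2) binomial_pmf n p k * f k).
  rewrite [X in _ = _ * X]big_ord_recl mulrDr mulrA mulr_sumr; congr (_ + _).
  by apply: eq_bigr => k _; rewrite /bump /= mulrA.
rewrite big_ord_recr /= binomial_pmf_small // mul0r addr0 mulr_sumr.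
by apply: eq_bigr => k _; ring.
Qed.

Lemma Ebinom0 f : Ebinom 0 f = f 0%N.
Proof.
by rewrite /Ebinom big_ord1 /binomial_pmf /= bin0 !expr0 !mul1r ?mulr1n ?mul1r.
Qed.

Lemma eq_Ebinom n f g : f =1 g -> Ebinom n f = Ebinom n g.
Proof. by move=> fg; apply: eq_bigr => k _; rewrite fg. Qed.

Lemma EbinomD n f g : Ebinom n (fun k => f k + g k) = Ebinom n f + Ebinom n g.
Proof. by rewrite -big_split /=; apply: eq_bigr => k _; rewrite mulrDr. Qed.

Lemma EbinomZ n c f : Ebinom n (fun k => c * f k) = c * Ebinom n f.
Proof. by rewrite mulr_sumr; apply: eq_bigr => k _; rewrite mulrCA. Qed.

Lemma Ebinom_cst n c : Ebinom n (fun=> c) = c.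
Proof.
elim: n => [|n IH]; first by rewrite Ebinom0.
by rewrite EbinomS -[RHS]IH; apply: eq_Ebinom => k; ring.
Qed.

Hypothesis p01 : 0 <= p <= 1.

Lemma le_Ebinom n f g : (forall k, f k <= g k) -> Ebinom n f <= Ebinom n g.
Proof.
by move=> fg; apply: ler_sum => k _; rewrite ler_wpM2l // binomial_pmf_ge0.
Qed.

Lemma Ebinom_dist n f g e : (forall k, `|f k - g k| <= e) ->
  `|Ebinom n f - Ebinom n g| <= e.
Proof.
move=> fg; rewrite ler_distl; apply/andP; split.
  rewrite -[e](Ebinom_cst n) -mulN1r -EbinomZ -EbinomD; apply: le_Ebinom => k.
  by have := fg k; rewrite ler_distl => /andP[]; lra.
rewrite -[e](Ebinom_cst n) -EbinomD; apply: le_Ebinom => k.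
by have := fg k; rewrite ler_distl => /andP[].
Qed.

(** Here [c] scales the centred count and [t] is the variance of one scaled
    trial. The trials are absorbed one at a time into the variance parameter
    of [heat], each at the cost given by [heat_step]. *)
Lemma Ebinom_heat (n : nat) (a r s x c t : R) : 0 < r -> r <= s ->
  p * (1 - p) * c ^+ 2 = t ->
  `|Ebinom n (fun k => heat a s (x + c * (k%:R - n%:R * p)))
    - heat a (s + n%:R * t) x| <=
  n%:R * (16 * phi 0 / (r * Num.sqrt r) * (`|c| * t)
          + 16 * phi 0 / r ^+ 2 * t ^+ 2).
Proof.
move=> r0 + tE; have t0 : 0 <= t.
  by case/andP: p01 => ? ?; rewrite -tE mulr_ge0 ?sqr_ge0 // mulr_ge0 ?subr_ge0.
set e := _ * _ + _; elim: n s => [|n IH] s rs.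
  by rewrite Ebinom0 !mul0r subr0 mulr0 !addr0 subrr normr0.
rewrite EbinomS.
have rst : r <= s + t by rewrite (le_trans rs) // lerDl.
set b := Ebinom n _.
have -> : b - heat a (s + n.+1%:R * t) x =
   (b - Ebinom n (fun k => heat a (s + t) (x + c * (k%:R - n%:R * p)))) +
   (Ebinom n (fun k => heat a (s + t) (x + c * (k%:R - n%:R * p)))
    - heat a (s + t + n%:R * t) x).
  by rewrite (_ : s + n.+1%:R * t = s + t + n%:R * t) -?natr1; ring.
apply: le_trans (ler_normD _ _) _.
rewrite -natr1 mulrDl mul1r addrC; apply: lerD; first exact: IH.
apply: Ebinom_dist => k; rewrite -!natr1.
have -> : x + c * (k%:R + 1 - (n%:R + 1) * p) =
  x + c * (k%:R - n%:R * p) + (1 - p) * c by ring.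
have -> : x + c * (k%:R - (n%:R + 1) * p) =
  x + c * (k%:R - n%:R * p) - p * c by ring.
exact: heat_step.
Qed.

Lemma Ebinom_id n : Ebinom n (fun k => k%:R) = n%:R * p.
Proof.
elim: n => [|n IH]; first by rewrite Ebinom0 mul0r.
rewrite EbinomS (@eq_Ebinom _ _ (fun k => k%:R + p)); last first.
  by move=> k; rewrite -natr1; ring.
by rewrite EbinomD IH Ebinom_cst -natr1; ring.
Qed.

Lemma Ebinom_centred n : Ebinom n (fun k => k%:R - n%:R * p) = 0.
Proof. by rewrite EbinomD Ebinom_id Ebinom_cst subrr. Qed.

Lemma Ebinom_sqr_centred n :
  Ebinom n (fun k => (k%:R - n%:R * p) ^+ 2) = n%:R * (p * (1 - p)).
Proof.
elim: n => [|n IH]; first by rewrite Ebinom0 !mul0r subrr expr0n.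
rewrite EbinomS
  (@eq_Ebinom _ _ (fun k => (k%:R - n%:R * p) ^+ 2 + p * (1 - p))); last first.
  by move=> k; rewrite -!natr1; ring.
by rewrite EbinomD IH Ebinom_cst -natr1; ring.
Qed.

(** The induction step needs the sharper bound [3 * n ^ 2 + n]: the fourth
    moment grows by at most [6 * n + 1] when [n] grows by 1. *)
Lemma Ebinom_centred4_le n :
  Ebinom n (fun k => (k%:R - n%:R * p) ^+ 4) <= 4 * n%:R ^+ 2.
Proof.
suff h : Ebinom n (fun k => (k%:R - n%:R * p) ^+ 4) <= 3 * n%:R ^+ 2 + n%:R.
  apply: le_trans h _; suff : n%:R <= n%:R ^+ 2 :> R by lra.
  rewrite -natrX ler_nat -mulnn.
  by have [->//|n_gt0] := posnP n; exact: leq_pmulr.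
have [p0 p1] := andP p01; elim: n => [|n IH].
  by rewrite Ebinom0 mul0r subrr !expr0n /= mulr0 addr0.
have pq0 : 0 <= p * (1 - p) by rewrite mulr_ge0 // subr_ge0.
have pq1 : p * (1 - p) <= 1 by nra.
rewrite EbinomS (@eq_Ebinom _ _ (fun k => (k%:R - n%:R * p) ^+ 4
   + (6 * (p * (1 - p)) * (k%:R - n%:R * p) ^+ 2
   + (4 * (p * (1 - p) * (1 - 2 * p)) * (k%:R - n%:R * p)
   + p * (1 - p) * (1 - 3 * (p * (1 - p)))))));
  last by move=> k; rewrite -!natr1; ring.
rewrite !EbinomD !EbinomZ Ebinom_sqr_centred Ebinom_centred Ebinom_cst.
have n0 : 0 <= n%:R :> R by [].
rewrite -natr1; set m := n%:R in IH n0 *; set w := p * (1 - p) in pq0 pq1 *.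
have : m * (w * w) <= m by rewrite ler_piMr // mulr_ile1.
nra.
Qed.

End binomial_expectation.

(** * The de Moivre-Laplace theorem *)

Section clt.
Variable R : realType.
Implicit Types (a b e eta p z : R) (n k : nat).

(** [heat (a + eta) (eta ^+ 4)] passes from 1 to 0 around [a + eta] within a
    distance of order [eta ^+ 2], which is small compared with the shift [eta]
    away from [a]. So it bounds the indicator of [z <= a] from above, up to a
    tail of the normal law; shifting to the left gives a lower bound. *)
Lemma indicator_le_heat a eta z : 0 < eta ->
  ((z <= a)%R : bool)%:R <= heat (a + eta) (eta ^+ 4) z + (1 - Phi eta^-1).
Proof.
move=> eta0; have [za|az] := boolP (z <= a).
  rewrite addrCA -[leLHS]addr0 lerD2l subr_ge0.
  apply: Phi_le; rewrite [eta ^+ 4](exprM eta 2 2).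
  rewrite sqrtr_sqr ger0_norm ?sqr_ge0 // ler_pdivlMr ?exprn_gt0 //.
  by rewrite expr2 mulKf ?gt_eqF //; lra.
by rewrite addr_ge0 ?subr_ge0 ?Phi_ge0 ?Phi_le1.
Qed.

Lemma heat_le_indicator a eta z : 0 < eta ->
  heat (a - eta) (eta ^+ 4) z - Phi (- eta^-1) <= ((z <= a)%R : bool)%:R.
Proof.
move=> eta0; have [za|] := boolP (z <= a).
  by rewrite lerBlDr (le_trans (Phi_le1 _)) // lerDl Phi_ge0.
rewrite -ltNge => az; rewrite subr_le0.
apply: Phi_le; rewrite [eta ^+ 4](exprM eta 2 2).
rewrite sqrtr_sqr ger0_norm ?sqr_ge0 // ler_pdivrMr ?exprn_gt0 //.
by rewrite mulNr expr2 mulKf ?gt_eqF //; lra.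
Qed.

Lemma Phi_continuous : continuous (@Phi R).
Proof.
move=> x; apply/differentiable_continuous/derivable1_diffP.
by have [] := is_derive_Phi x.
Qed.

Lemma heat_cvg a (s : R) :
  heat (a + s * eta) (eta ^+ 4 + 1) 0 @[eta --> 0^'+] --> Phi a.
Proof.
have -> : Phi a = heat (a + s * 0) (0 ^+ 4 + 1) 0.
  by rewrite /heat expr0n /= add0r sqrtr1 divr1 mulr0 addr0 subr0.
apply: (@cvg_at_right_filter _ _
  (fun eta => heat (a + s * eta) (eta ^+ 4 + 1) 0)).
have h1 : (x ^+ 4 + 1 : R) @[x --> (0 : R)] --> (0 ^+ 4 + 1 : R).
  by apply: cvgD; [exact: exprn_continuous|exact: cvg_cst].
have h2 : Num.sqrt (x ^+ 4 + 1) @[x --> (0 : R)] --> Num.sqrt (0 ^+ 4 + 1 : R).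
  by apply: (continuous_cvg _ _ h1); exact: sqrt_continuous.
have h3 : (a + s * x - 0 : R) @[x --> (0 : R)] --> (a + s * 0 - 0 : R).
  apply: cvgB; last exact: cvg_cst.
  by apply: cvgD; [exact: cvg_cst|apply: cvgM; [exact: cvg_cst|exact: cvg_id]].
have h0 : Num.sqrt (0 ^+ 4 + 1) != 0 :> R.
  by rewrite sqrtr_eq0 -ltNge expr0n /= add0r ltr01.
apply: (continuous_cvg _ _ (cvgM h3 (cvgV h0 h2))).
exact: Phi_continuous.
Qed.

Lemma cvg_inv_at_right : (x : R)^-1 @[x --> 0^'+] --> +oo.
Proof.
apply/cvgrVy; last exact/cvg_at_right_filter/cvg_id.
exact: nbhs_right_gt.
Qed.

Lemma heat_ub_cvg a :
  heat (a + eta) (eta ^+ 4 + 1) 0 + (1 - Phi eta^-1) @[eta --> 0^'+] --> Phi a.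
Proof.
rewrite -[X in _ --> X]addr0 -[X in _ --> _ + X](subrr (1:R)); apply: cvgD.
  have := @heat_cvg a 1; under eq_fun do rewrite mul1r; exact.
apply: cvgB; first exact: cvg_cst.
exact: (cvg_comp _ _ cvg_inv_at_right (@cvg_Phiy R)).
Qed.

Lemma heat_lb_cvg a :
  heat (a - eta) (eta ^+ 4 + 1) 0 - Phi (- eta^-1) @[eta --> 0^'+] --> Phi a.
Proof.
rewrite -[X in _ --> X]subr0; apply: cvgB.
  have := @heat_cvg a (-1); under eq_fun do rewrite mulN1r; exact.
apply: (cvg_comp _ _ _ (@cvg_PhiNy R)).
by apply/cvgNrNy; exact: cvg_inv_at_right.
Qed.

(** The sign [e] is there because the index is an affine function of the count
    whose slope may be negative. *)
Definition standardized e p n k : R :=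
  e * (k%:R - n%:R * p) / Num.sqrt (n%:R * (p * (1 - p))).

Lemma Ebinom_heat_cvg p e b r : 0 < p < 1 -> `|e| = 1 -> 0 < r ->
  Ebinom p n (fun k => heat b r (standardized e p n k)) @[n --> \oo]
    --> heat b (r + 1) 0.
Proof.
move=> /andP[p0 p1] e1 r0.
have pq0 : 0 < p * (1 - p) by rewrite mulr_gt0 // subr_gt0.
pose K1 := 16 * phi 0 / (r * Num.sqrt r) : R.
pose K2 := 16 * phi 0 / r ^+ 2 : R.
have bound n : (0 < n)%N ->
    `|heat b (r + 1) 0
      - Ebinom p n (fun k => heat b r (standardized e p n k))|
    <= K1 / Num.sqrt (p * (1 - p)) * (Num.sqrt n%:R)^-1 + K2 * n%:R^-1.
  move=> n0; have nR : n%:R != 0 :> R by rewrite pnatr_eq0 -lt0n.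
  pose c := e / Num.sqrt (n%:R * (p * (1 - p))).
  have c2 : p * (1 - p) * c ^+ 2 = n%:R^-1.
    rewrite exprMn -real_normK ?num_real // e1 expr1n mul1r exprVn sqr_sqrtr.
      by rewrite invfM mulrCA mulfV ?mulr1 // gt_eqF.
    by rewrite mulr_ge0 // ltW.
  have p01 : 0 <= p <= 1 by rewrite !ltW.
  have := @Ebinom_heat R p p01 n b r r 0 c _ r0 (lexx r) c2.
  rewrite mulfV // distrC.
  rewrite (@eq_Ebinom _ _ _ _ (fun k => heat b r (standardized e p n k)));
    last by move=> k; rewrite add0r mulrAC.
  move=> h; apply: le_trans h _; rewrite -/K1 -/K2.
  rewrite mulrDr; apply: lerD.
    rewrite normrM e1 mul1r ger0_norm ?invr_ge0 ?sqrtr_ge0 // sqrtrM // invfM.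
    rewrite le_eqVlt; apply/orP; left; apply/eqP.
    set u := (Num.sqrt n%:R)^-1; set w := (Num.sqrt (p * _))^-1; field.
    by rewrite nR.
  rewrite le_eqVlt; apply/orP; left; apply/eqP; field.
  by rewrite nR.
apply/cvgrPdist_le => eps eps0.
have : K1 / Num.sqrt (p * (1 - p)) * (Num.sqrt n%:R)^-1 + K2 * n%:R^-1
    @[n --> \oo] --> (0 : R).
  have n_y : (n%:R : R) @[n --> \oo] --> +oo by exact: cvgr_idn.
  rewrite -[X in _ --> X]addr0.
  rewrite -[X in _ --> X + _](mulr0 (K1 / Num.sqrt (p * (1 - p)))).
  rewrite -[X in _ --> _ + X](mulr0 K2).
  apply: cvgD; apply: cvgM; try exact: cvg_cst.
    apply/gtr0_cvgV0.
      by near=> n; rewrite sqrtr_gt0 ltr0n; near: n; exact: nbhs_infty_gt.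
    apply/cvgryPge => M; near=> n.
    apply: (@le_trans _ _ (Num.sqrt (M ^+ 2))).
      by rewrite sqrtr_sqr ler_norm.
    rewrite ler_wsqrtr //; near: n; move/cvgryPge : n_y; exact.
  apply/gtr0_cvgV0; last exact: n_y.
  by near=> n; rewrite ltr0n; near: n; exact: nbhs_infty_gt.
move/cvgrPdist_le => /(_ _ eps0) h.
near=> n; apply: le_trans (bound n _) _; first by near: n; exact: nbhs_infty_gt.
apply: le_trans (ler_norm _) _; rewrite -normrN -sub0r; near: n; exact: h.
Unshelve. all: by end_near.
Qed.

(** The indicator of [z <= a] lies between the two smooth functions of
    [heat_le_indicator] and [indicator_le_heat]; for a fixed [eta] their
    expectations converge by [Ebinom_heat_cvg], and the limits tend to [Phi a]
    as [eta] tends to 0. *)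
Lemma binomial_clt p e a : 0 < p < 1 -> `|e| = 1 ->
  Ebinom p n (fun k => ((standardized e p n k <= a)%R : bool)%:R) @[n --> \oo]
    --> Phi a.
Proof.
move=> p01 e1; apply/cvgrPdist_le => eps eps0.
have eps2 : 0 < eps / 2 by rewrite divr_gt0.
have [eta [eta0 U L]] : exists eta : R, [/\ 0 < eta,
    heat (a + eta) (eta ^+ 4 + 1) 0 + (1 - Phi eta^-1) <= Phi a + eps / 2 &
    Phi a - eps / 2 <= heat (a - eta) (eta ^+ 4 + 1) 0 - Phi (- eta^-1)].
  have : \forall eta \near (0:R)^'+, [/\ 0 < eta,
    heat (a + eta) (eta ^+ 4 + 1) 0 + (1 - Phi eta^-1) <= Phi a + eps / 2 &
    Phi a - eps / 2 <= heat (a - eta) (eta ^+ 4 + 1) 0 - Phi (- eta^-1)].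
    near=> eta; split.
    - by near: eta; exact: nbhs_right_gt.
    - have : `|Phi a - (heat (a + eta) (eta ^+ 4 + 1) 0 + (1 - Phi eta^-1))| <= eps / 2.
        by near: eta; move/cvgrPdist_le: (@heat_ub_cvg a) => /(_ _ eps2).
      by rewrite ler_distl => /andP[]; lra.
    - have : `|Phi a - (heat (a - eta) (eta ^+ 4 + 1) 0 - Phi (- eta^-1))| <= eps / 2.
        by near: eta; move/cvgrPdist_le: (@heat_lb_cvg a) => /(_ _ eps2).
      by rewrite ler_distl => /andP[]; lra.
  by move/filter_ex.
have eta4 : 0 < eta ^+ 4 by rewrite exprn_gt0.
have p01' : 0 <= p <= 1 by case/andP: p01 => ? ?; rewrite !ltW.
near=> n.
have HU : `|heat (a + eta) (eta ^+ 4 + 1) 0 - Ebinom p n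
    (fun k => heat (a + eta) (eta ^+ 4) (standardized e p n k))| <= eps / 2.
  near: n; move/cvgrPdist_le: (@Ebinom_heat_cvg p e (a + eta) _ p01 e1 eta4).
  exact.
have HL : `|heat (a - eta) (eta ^+ 4 + 1) 0 - Ebinom p n
    (fun k => heat (a - eta) (eta ^+ 4) (standardized e p n k))| <= eps / 2.
  near: n; move/cvgrPdist_le: (@Ebinom_heat_cvg p e (a - eta) _ p01 e1 eta4).
  exact.
have := @le_Ebinom R p p01' n _ _
  (fun k => indicator_le_heat a (standardized e p n k) eta0).
have := @le_Ebinom R p p01' n _ _
  (fun k => heat_le_indicator a (standardized e p n k) eta0).
rewrite !EbinomD !Ebinom_cst.
move: HU HL; rewrite !ler_distl => /andP[? ?] /andP[? ?] ? ?.
by apply/andP; split; lra.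
Unshelve. all: by end_near.
Qed.

End clt.

(** * Counting successes in independent trials *)

Section bernoulli_trials.
Context d d' (T : measurableType d) (T' : measurableType d') (R : realType)
  (P : probability T R).
Variables (X : nat -> {RV P >-> T'}) (S : set T') (m : nat) (p : R).
Hypothesis mS : measurable S.
Hypothesis X_indep : mutually_independent [set i | (m <= i)%N] X.
Hypothesis PX : forall i, (m <= i)%N -> P (X i @^-1` S) = p%:E.

Definition successes (n : nat) (w : T) : nat :=
  \sum_(m <= i < m + n) (X i w \in S).

Lemma successes0 w : successes 0 w = 0%N.
Proof. by rewrite /successes addn0 big_geq. Qed.

Lemma successesS n w :
  successes n.+1 w = (successes n w + (X (m + n)%N w \in S))%N.
Proof. by rewrite /successes addnS big_nat_recr ?leq_addr. Qed.

Lemma successes_le n w : (successes n w <= n)%N.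
Proof.
elim: n => [|n IH]; first by rewrite successes0.
by rewrite successesS -addn1 leq_add // leq_b1.
Qed.

Lemma measurable_preimage_RV i (E : set T') :
  measurable E -> measurable (X i @^-1` E).
Proof. by move=> mE; rewrite -[_ @^-1` _]setTI; exact: measurable_funP. Qed.

Lemma successesS_preimage n (U : set nat) :
  successes n.+1 @^-1` U =
    (successes n @^-1` (succn @^-1` U) `&` X (m + n)%N @^-1` S) `|`
    (successes n @^-1` U `&` X (m + n)%N @^-1` (~` S)).
Proof.
apply/seteqP; split => w /=; rewrite successesS.
  have [/set_mem XS|/negP XS] := boolP (X (m + n)%N w \in S).
    by rewrite addn1; left.
  by rewrite addn0 => Uw; right; split => // Sw; apply: XS; rewrite inE.
case=> -[Uw XS]; first by rewrite mem_set // addn1.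
by rewrite memNset // addn0.
Qed.

Lemma measurable_successes_preimage n (U : set nat) :
  measurable (successes n @^-1` U).
Proof.
elim: n U => [|n IH] U.
  have -> : successes 0 = cst 0%N by apply/funext => w; rewrite successes0.
  rewrite preimage_cst; case: ifP => _; [exact: measurableT|exact: measurable0].
rewrite successesS_preimage; apply: measurableU; apply: measurableI; rewrite ?IH //.
  exact: measurable_preimage_RV.
by apply: measurable_preimage_RV; exact: measurableC.
Qed.

Lemma measurable_successes n : measurable_fun setT (successes n).
Proof. by move=> _ U _; rewrite setTI; exact: measurable_successes_preimage. Qed.

Definition successes_RV n : {RV P >-> nat} :=
  HB.pack (successes n)
    (isMeasurableFun.Build _ _ _ _ _ (measurable_successes n)).

(** The law of the count is proved jointly with arbitrary events on later
    trials, so that the induction can move one trial from these events into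
    the count and use the product rule only for the initial case. *)
Lemma successes_indep n k (s : seq nat) (E : nat -> set T') :
  uniq s -> {in s, forall i, (m + n <= i)%N} -> (forall i, measurable (E i)) ->
  P (successes n @^-1` [set k] `&` \bigcap_(i in [set` s]) (X i @^-1` E i)) =
    ((binomial_pmf n p k)%:E * \prod_(i <- s) P (X i @^-1` E i))%E.
Proof.
elim: n k s E => [|n IH] k s E us ms mE.
  have -> : successes 0 = cst 0%N by apply/funext => w; rewrite successes0.
  case: k => [|k].
    rewrite preimage_cst mem_set // setTI X_indep //.
      by rewrite /binomial_pmf bin0 !expr0 mul1r mulr1n mul1e.
    by move=> i /= /ms; rewrite addn0.
  rewrite preimage_cst memNset // set0I measure0.
  by rewrite binomial_pmf_small // mul0e.
pose E' (F : set T') i := if i == (m + n)%N then F else E i.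
have sN : (m + n)%N \notin s.
  by apply/negP => /ms; rewrite addnS ltnn.
have us' : uniq ((m + n)%N :: s) by rewrite /= sN.
have ms' : {in (m + n)%N :: s, forall i, (m + n <= i)%N}.
  by move=> i; rewrite inE => /orP[/eqP -> //|/ms]; rewrite addnS => /ltnW.
have mE' F : measurable F -> forall i, measurable (E' F i).
  by move=> mF i; rewrite /E'; case: ifP.
have capE F : X (m + n)%N @^-1` F `&` \bigcap_(i in [set` s]) (X i @^-1` E i) =
    \bigcap_(i in [set` (m + n)%N :: s]) (X i @^-1` E' F i).
  apply/seteqP; split => w /=.
    move=> [Fw Ew] i /=; rewrite inE /E'; case: eqP => [-> //|_ /= si].
    exact: Ew.
  move=> Ew; split.
    by have := Ew (m + n)%N; rewrite /E' /= eqxx inE eqxx; apply.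
  move=> i /= si; have := Ew i; rewrite /= inE si orbT /E'.
  by case: eqP => [im|_]; [rewrite -im si in sN|apply].
have step F j : measurable F ->
    P (successes n @^-1` [set j] `&` (X (m + n)%N @^-1` F `&`
         \bigcap_(i in [set` s]) (X i @^-1` E i))) =
    ((binomial_pmf n p j)%:E * (P (X (m + n)%N @^-1` F) *
      \prod_(i <- s) P (X i @^-1` E i)))%E.
  move=> mF; rewrite capE IH //; last exact: mE'.
  rewrite big_cons /E' eqxx; congr (_ * (_ * _))%E.
  by apply: eq_big_seq => i si; case: eqP => // im; rewrite -im si in sN.
have mcap : measurable (\bigcap_(i in [set` s]) (X i @^-1` E i)).
  by apply: fin_bigcap_measurable => // i _; exact: measurable_preimage_RV.
have mC : measurable (~` S) by exact: measurableC.
have PC : P (X (m + n)%N @^-1` (~` S)) = (1 - p)%:E.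
  rewrite preimage_setC probability_setC ?PX ?leq_addr //.
  exact: measurable_preimage_RV.
have PU (A B : set T) : measurable A -> measurable B -> A `&` B = set0 ->
    P (A `|` B) = (P A + P B)%E by exact: measureU.
rewrite successesS_preimage setIUl PU.
- rewrite -!setIA; case: k => [|k].
    have -> : succn @^-1` [set 0%N] = set0 by apply/seteqP; split.
    rewrite preimage_set0 set0I measure0 add0e. rewrite step // PC.
    by rewrite binomial_pmfS0 [in RHS]mulrC EFinM muleA.
  have -> : succn @^-1` [set k.+1] = [set k].
    by apply/seteqP; split => i /=; [case|move=> ->].
  rewrite !step // PC PX ?leq_addr // binomial_pmfS.
  set q := (\prod_(i <- s) _)%E.
  have : q \is a fin_num.
    rewrite /q; elim/big_ind : _ => //; first by move=> x y; exact: fin_numM.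
    by move=> i _; rewrite fin_num_measure //; exact: measurable_preimage_RV.
  move: q => q /fineK qE.
  have {qE} [r ->] : exists r : R, q = r%:E by exists (fine q).
  transitivity ((binomial_pmf n p k * (p * r)
    + binomial_pmf n p k.+1 * ((1 - p) * r))%:E) => //.
  rewrite [RHS](_ : _ = ((p * binomial_pmf n p k
    + (1 - p) * binomial_pmf n p k.+1) * r)%:E) //.
  by congr EFin; ring.
- apply: measurableI => //; apply: measurableI.
    exact: measurable_successes_preimage.
  exact: measurable_preimage_RV.
- apply: measurableI => //; apply: measurableI.
    exact: measurable_successes_preimage.
  exact: measurable_preimage_RV.
- by apply/seteqP; split => // w /= [[[_ Sw] _] [[_ Cw] _]]; exact: Cw.
Qed.

Lemma probability_successes n k :
  P (successes n @^-1` [set k]) = (binomial_pmf n p k)%:E.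
Proof.
have := @successes_indep n k [::] (fun=> setT) isT _ (fun=> measurableT).
rewrite big_nil mule1 => <- //; congr (P _).
by apply/seteqP; split => [w kw|w []] //; split.
Qed.

Lemma distribution_successes n (U : set nat) : 0 <= p <= 1 ->
  distribution P (successes_RV n) U = binomial_prob n p U.
Proof.
move=> p01; rewrite /distribution /pushforward /binomial_prob p01 /=.
have -> : successes n @^-1` U = \bigcup_(k in U) (successes n @^-1` [set k]).
  apply/seteqP; split => [w Uw|w [k Uk /= wk]].
    by exists (successes n w).
  by rewrite /preimage /= wk.
rewrite measure_bigcup.
- rewrite nneseries_esum; last by move=> k _; exact: measure_ge0.
  rewrite set_mem_set; apply: eq_esum => k _.
  exact: probability_successes.
- by move=> k _; exact: measurable_successes_preimage.
- by move=> i j _ _ [w [/= <- <-]].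
Qed.

Lemma expectation_successes n (f : nat -> R) :
  ('E_P[fun w => f (successes n w)] = (Ebinom p n f)%:E)%E.
Proof.
rewrite unlock.
have mA k : measurable (successes n @^-1` [set k]).
  exact: measurable_successes_preimage.
rewrite (eq_integral (fun w => \sum_(k < n.+1)
    ((f k)%:E * (\1_(successes n @^-1` [set val k]) w)%:E)%E)); last first.
  move=> w _; rewrite /= (bigD1 (inord (successes n w))) //=.
  rewrite inordK ?ltnS ?successes_le //.
  rewrite indicE mem_set // mule1 big1 ?adde0 // => k kw.
  rewrite indicE memNset ?mule0 //= => wk; move/eqP: kw; apply.
  by apply: val_inj; rewrite /= inordK ?ltnS ?successes_le.
rewrite integral_sum //; last first.
  by move=> k; apply: integrableZl => //; exact: integrable_indic.
rewrite /Ebinom -sumEFin; apply: eq_bigr => k _.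
rewrite integralZl //; last exact: integrable_indic.
rewrite integral_indic // setIT muleC EFinM; congr (_ * _)%E.
exact: probability_successes.
Qed.

End bernoulli_trials.

(** * The strong law of large numbers *)

Section strong_law.
Context d d' (T : measurableType d) (T' : measurableType d') (R : realType)
  (P : probability T R).
Variables (X : nat -> {RV P >-> T'}) (S : set T') (m : nat) (p : R).
Hypothesis mS : measurable S.
Hypothesis X_indep : mutually_independent [set i | (m <= i)%N] X.
Hypothesis PX : forall i, (m <= i)%N -> P (X i @^-1` S) = p%:E.
Hypothesis p01 : 0 <= p <= 1.

Lemma measurable_fun_successes d1 (T1 : measurableType d1) n (f : nat -> T1) :
  measurable_fun setT (fun w => f (successes X S m n w)).
Proof.
move=> _ U _; rewrite setTI.
exact: (@measurable_successes_preimage _ _ _ _ _ _ X S m mS n (f @^-1` U)).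
Qed.

(** Each term is at most [2 / k.+1 - 2 / k.+2], and these telescope. *)
Lemma sum_inv_sqr_le n :
  \sum_(0 <= k < n) (k.+1%:R ^- 2) <= 2 - 2 / n.+1%:R :> R.
Proof.
elim: n => [|n IH]; first by rewrite big_geq // divr1 subrr.
rewrite big_nat_recr //=; apply: le_trans (lerD IH (lexx _)) _.
rewrite -[n.+2%:R]natr1 -[n.+1%:R]natr1.
set x : R := n%:R; have x0 : 0 <= x by [].
have x1 : 0 < x + 1 by rewrite ltr_wpDl.
have x2 : 0 < x + 1 + 1 by rewrite ltr_wpDl // ltW.
rewrite -subr_ge0.
have -> : 2 - 2 / (x + 1 + 1) - (2 - 2 / (x + 1) + (x + 1) ^- 2) =
   x / ((x + 1) ^+ 2 * (x + 1 + 1)).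
  by field; rewrite !gt_eqF.
by rewrite divr_ge0 // mulr_ge0 ?sqr_ge0 // ltW.
Qed.

(** The fourth moments of the centred averages are summable, so by monotone
    convergence the series of their fourth powers has a finite expectation.
    It is then almost surely finite, and its terms tend to 0. *)
Lemma strong_law_successes :
  {ae P, forall w, (successes X S m n w)%:R / n%:R @[n --> \oo] --> p}.
Proof.
pose Y n w : R := (((successes X S m n.+1 w)%:R - n.+1%:R * p) / n.+1%:R) ^+ 4.
have Y0 n w : 0 <= Y n w by rewrite /Y (exprM _ 2 2) sqr_ge0.
have mY n : measurable_fun setT (EFin \o Y n).
  apply/measurable_EFinP.
  exact: (@measurable_fun_successes _ _ n.+1
    (fun k => ((k%:R - n.+1%:R * p) / n.+1%:R) ^+ 4)).
have EY n : (\int[P]_w (Y n w)%:E <= (4 * n.+1%:R ^- 2)%:E)%E.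
  have := expectation_successes mS X_indep PX n.+1
    (fun k => ((k%:R - n.+1%:R * p) / n.+1%:R) ^+ 4).
  rewrite unlock => ->; rewrite lee_fin.
  rewrite (@eq_Ebinom _ _ _ _
    (fun k => n.+1%:R ^- 4 * (k%:R - n.+1%:R * p) ^+ 4)); last first.
    by move=> k; rewrite exprMn exprVn mulrC.
  rewrite EbinomZ.
  have n0 : 0 < n.+1%:R :> R by [].
  apply: (@le_trans _ _ (n.+1%:R ^- 4 * (4 * n.+1%:R ^+ 2))).
    by rewrite ler_wpM2l ?invr_ge0 ?exprn_ge0 // Ebinom_centred4_le.
  rewrite le_eqVlt; apply/orP; left; apply/eqP.
  set x : R := n.+1%:R in n0 *; field.
  by rewrite gt_eqF.
have sumY : (\int[P]_w (\sum_(0 <= n <oo) (Y n w)%:E) < +oo)%E.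
  rewrite integral_nneseries //; last by move=> n w _; rewrite lee_fin.
  apply: (@le_lt_trans _ _ 8%:E); last by rewrite ltry.
  apply: lime_le.
    apply: is_cvg_ereal_nneg_natsum => n _; apply: integral_ge0 => w _.
    by rewrite lee_fin.
  apply: nearW => n.
  apply: (@le_trans _ _ (\sum_(0 <= k < n) (4 * k.+1%:R ^- 2)%:E)%E).
    by apply: lee_sum => k _; exact: EY.
  rewrite sumEFin lee_fin -mulr_sumr.
  have := sum_inv_sqr_le n.
  have : 0 <= 2 / n.+1%:R :> R by rewrite divr_ge0.
  move: (\sum_(0 <= k < n) _) (2 / _) => s t; lra.
have iY : P.-integrable setT (fun w => (\sum_(0 <= n <oo) (Y n w)%:E)%E).
  apply/integrableP; split.
    apply: ge0_emeasurable_sum => [k w _ _|k _]; last exact: mY.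
    by rewrite lee_fin.
  rewrite (eq_integral (fun w => (\sum_(0 <= n <oo) (Y n w)%:E)%E)) // => w _.
  by rewrite gee0_abs // nneseries_ge0 // => n _ _; rewrite lee_fin.
have := integrable_ae measurableT iY; apply: filterS => w /(_ I) fin.
have cY : Y n w @[n --> \oo] --> (0 : R).
  apply: cvg_series_cvg_0.
  apply: nondecreasing_is_cvgn.
    by apply/nondecreasing_seqP => n; rewrite /series /= big_nat_recr //= lerDl.
  exists (fine (\sum_(0 <= n <oo) (Y n w)%:E)%E) => _ [n _ <-] /=.
  rewrite -lee_fin fineK // -sumEFin.
  by apply: nneseries_lim_ge => k _ _; rewrite lee_fin.
rewrite -cvg_shiftS; apply/cvgrPdist_lt => e e0.
have e4 : 0 < e ^+ 4 by rewrite exprn_gt0.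
move/cvgrPdist_lt : cY => /(_ _ e4); apply: filterS => n /=.
rewrite sub0r normrN ger0_norm // => Ye.
have n0 : n.+1%:R != 0 :> R by rewrite pnatr_eq0.
rewrite distrC -(@ltr_pXn2r _ 4) ?nnegrE ?(ltW e0) //.
apply: le_lt_trans Ye; rewrite le_eqVlt; apply/orP; left; apply/eqP.
rewrite /Y mulrBl (mulrC n.+1%:R) mulfK //.
by rewrite -normrX ger0_norm // (exprM _ 2 2) sqr_ge0.
Qed.

End strong_law.

(** * Random phenylene chains *)

Lemma random_chain_phenylene d (T : measurableType d) (R : realType)
    (P : probability T R) (p1 p2 : R) (L : nat -> {RV P >-> link_type})
    (RPC : nat -> T -> chain) :
  random_phenylene_chain p1 p2 L RPC ->
  forall n w, (2 <= n)%N -> phenylene_chain (L ^~ w) n (RPC n w).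
Proof.
move=> [_ _ RPC2 RPCS]; elim=> [//|n IH] w.
rewrite leq_eqVlt => /orP[/eqP <-|n3]; first exact: phenylene_chain2.
apply: phenylene_chainS => //; last exact: RPCS.
exact: IH.
Qed.

Theorem corollary3p1 (R : realType) (h : nat -> nat -> R)
    (h_sym : forall x y : nat, (0 < x)%N -> (0 < y)%N -> h x y = h y x) :
  let A := 2 * h 2%N 3%N - h 2%N 2%N - h 3%N 3%N in
  let B := h 2%N 2%N + 2 * h 2%N 3%N + 5 * h 3%N 3%N in
  let C := 4 * h 2%N 2%N - 6 * h 3%N 3%N in
  (forall (d : measure_display) (T : measurableType d) (P : probability T R)
      (p1 p2 : R) (L : nat -> {RV P >-> link_type}) (RPC : nat -> T -> chain),
    0 <= p1 -> 0 <= p2 -> p1 + p2 <= 1 ->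
    random_phenylene_chain p1 p2 L RPC ->
    let TIn : nat -> T -> R := fun n w => TI h (RPC n w) in
    [/\ (* (a) *)
        forall n, (2 <= n)%N ->
          exists X : {RV P >-> nat},
            (forall E : set nat,
               distribution P X E = binomial_prob (n - 2) p1 E) /\
            (forall w, TIn n w = A * (X w)%:R + B * n%:R + C),
        (* (b) *)
        forall n, (2 <= n)%N ->
          'E_P[TIn n]%E = ((A * p1 + B) * n%:R - 2 * A * p1 + C)%:E,
        (* (c) *)
        forall n, (2 <= n)%N ->
          'V_P[TIn n]%E = (A ^+ 2 * p1 * (1 - p1) * (n%:R - 2))%:E,
        (* (d) *)
        A != 0 -> 0 < p1 < 1 ->
          cvg_in_distribution P
            (fun n w => (TIn n w - fine 'E_P[TIn n]%E) /
                        Num.sqrt (fine 'V_P[TIn n]%E))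
            (normal_prob 0 1)
      & (* (e) *)
        {ae P, forall w, TIn n w / n%:R @[n --> \oo] --> A * p1 + B}]) /\
  (forall (l : nat -> link_type) (n : nat) (rpc : chain),
    (2 <= n)%N -> phenylene_chain l n rpc ->
    let n1 := (\sum_(3 <= i < n.+1) (l i == Link1))%N in
    TI h rpc = A * n1%:R + B * n%:R + C).
Proof.
move=> A B C; split; last first.
  by move=> l n G n2 lG n1; rewrite (TI_phenylene_chain h_sym lG).
move=> d T P p1 p2 L RPC p1_ge0 p2_ge0 p12 hRPC TIn.
have [PL L_indep _ _] := hRPC.
pose S := [set Link1].
have mS : measurable S by [].
have PS i : (3 <= i)%N -> P (L i @^-1` S) = p1%:E by case/PL.
have p01 : 0 <= p1 <= 1 by apply/andP; split=> //; lra.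
pose K n := successes L S 3 (n - 2).
have TIE n : (2 <= n)%N -> TIn n = fun w => A * (K n w)%:R + B * n%:R + C.
  move=> n2; apply/funext => w.
  rewrite /TIn (TI_phenylene_chain h_sym (random_chain_phenylene hRPC w n2)).
  rewrite /K /successes -/A -/B -/C (_ : 3 + (n - 2) = n.+1)%N; last first.
    by rewrite -[in RHS](subnKC n2).
  congr (_ * _%:R + _ + _); apply: eq_bigr => i _.
  by rewrite in_set1.
clearbody A B C.
have nE n : (2 <= n)%N -> (n - 2)%:R = n%:R - 2 :> R.
  by move=> n2; rewrite natrB.
have ETI n : (2 <= n)%N ->
    'E_P[TIn n]%E = ((A * p1 + B) * n%:R - 2 * A * p1 + C)%:E.
  move=> n2; rewrite TIE //.
  rewrite (expectation_successes mS L_indep PS (n - 2)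
    (fun k => A * k%:R + B * n%:R + C)).
  congr EFin; rewrite !EbinomD EbinomZ !Ebinom_cst Ebinom_id nE //; ring.
have VTI n : (2 <= n)%N ->
    'V_P[TIn n]%E = (A ^+ 2 * p1 * (1 - p1) * (n%:R - 2))%:E.
  move=> n2; rewrite /variance unlock ETI //= TIE //.
  transitivity ('E_P[fun w =>
      (A ^+ 2 * ((K n w)%:R - (n - 2)%:R * p1) ^+ 2)%R])%E.
    by congr expectation; apply/funext => w; rewrite !fctE /= nE //; ring.
  rewrite (expectation_successes mS L_indep PS (n - 2)
    (fun k => A ^+ 2 * (k%:R - (n - 2)%:R * p1) ^+ 2)).
  by congr EFin; rewrite EbinomZ Ebinom_sqr_centred nE //; ring.
split => //.
- move=> n n2; exists (successes_RV L 3 mS (n - 2)); split.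
    by move=> E; exact: distribution_successes.
  by move=> w; rewrite TIE.
- move=> A0 /andP[p1_gt0 p1_lt1] x _.
  have sg1 : `|Num.sg A| = 1 by rewrite normr_sg A0.
  have p1_01 : 0 < p1 < 1 by rewrite p1_gt0.
  (* The distribution function of the standardized index, at x. *)
  set Z := fun n : nat => _.
  suff : Z n @[n --> \oo] --> (Phi x)%:E by rewrite -Phi_fin; exact.
  pose z n := standardized (Num.sg A) p1 n.
  have ZE n : (2 <= n)%N ->
      Z n = (Ebinom p1 (n - 2)
        (fun k => ((z (n - 2)%N k <= x)%R : bool)%:R))%:E.
    move=> n2; pose U := K n @^-1` [set k | z (n - 2)%N k <= x].
    have ZnE w :
        (TIn n w - fine 'E_P[TIn n]%E) / Num.sqrt (fine 'V_P[TIn n]%E) =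
        z (n - 2)%N (K n w).
      rewrite ETI // VTI //= TIE //= /z /standardized nE //.
      have -> : A ^+ 2 * p1 * (1 - p1) * (n%:R - 2) =
        A ^+ 2 * ((n%:R - 2) * (p1 * (1 - p1))) by ring.
      rewrite sqrtrM ?sqr_ge0 // sqrtr_sqr invfM [LHS]mulrA; congr (_ * _).
      apply: (mulIf (x := `|A|)); first by rewrite normr_eq0.
      rewrite divfK ?normr_eq0 // [RHS]mulrAC -numEsg; ring.
    have -> : Z n = P U.
      by congr (P _); apply/seteqP; split => w; rewrite /U /= in_itv /= ZnE.
    have mU : measurable U.
      exact: (@measurable_successes_preimage _ _ _ _ _ _ L S 3 mS).
    rewrite -(expectation_successes mS L_indep PS (n - 2)) -expectation_indic //.
    congr expectation; apply/funext => w; rewrite indicE; congr (nat_of_bool _)%:R.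
    by apply/idP/idP; rewrite inE.
  have cF := cvg_comp _ _ (@cvg_subnr 2)
    (@binomial_clt R p1 (Num.sg A) x p1_01 sg1).
  apply: cvg_EFin.
    by near=> n; rewrite ZE //; near: n; exact: nbhs_infty_ge.
  apply: cvg_trans cF; apply: near_eq_cvg; near=> n.
  by rewrite /= ZE //; near: n; exact: nbhs_infty_ge.
- have := strong_law_successes mS L_indep PS p01; apply: filterS => w slln.
  have slln2 := cvg_comp _ _ (@cvg_subnr 2) slln.
  have inv0 : (n%:R : R)^-1 @[n --> \oo] --> (0 : R).
    apply/gtr0_cvgV0; last exact: cvgr_idn.
    by near=> n; rewrite ltr0n; near: n; exact: nbhs_infty_gt.
  have lim : A * ((successes L S 3 (n - 2) w)%:R / (n - 2)%:R)
        * (1 - 2 * n%:R^-1) + B + C * n%:R^-1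
      @[n --> \oo] --> A * p1 * (1 - 2 * 0) + B + C * 0.
    apply: cvgD; last by apply: cvgM; [exact: cvg_cst|exact: inv0].
    apply: cvgD; last exact: cvg_cst.
    apply: cvgM; first by apply: cvgM; [exact: cvg_cst|exact: slln2].
    by apply: cvgB; [exact: cvg_cst|apply: cvgM; [exact: cvg_cst|exact: inv0]].
  have -> : A * p1 + B = A * p1 * (1 - 2 * 0) + B + C * 0 by ring.
  apply: cvg_trans lim; apply: near_eq_cvg; near=> n.
  have n3 : (3 <= n)%N by near: n; exact: nbhs_infty_ge.
  rewrite TIE ?(ltnW n3) // nE ?(ltnW n3) // -/(K n w).
  field.
  rewrite -nE ?(ltnW n3) // !pnatr_eq0 subn_eq0 -ltnNge n3 andbT.
  by rewrite -lt0n (leq_trans _ n3).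
Unshelve. all: by end_near.
Qed.
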